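(* Let $\vec{v}\in\mathbb{R}^3$ be a unit vector and let $\Sigma$ be a rotational surface in $\mathbb{R}^3$. If $\Sigma$ is a $\lambda$-translator with speed $\vec{v}$ for some $\lambda\in\mathbb{R}$, then $\Sigma$ is (part of) a plane or its rotation axis is parallel to $\vec{v}$.
   Context: Let $\vec{v}\in\mathbb{R}^3$ with $|\vec{v}|=1$ and $\lambda\in\mathbb{R}$. An oriented surface $\Sigma$ immersed in Euclidean space $\mathbb{R}^3$, with unit normal $N$ and Gauss curvature $K$, is a $\lambda$-translator with speed $\vec{v}$ if $K=\langle N,\vec{v}\rangle+\lambda$ at every point of $\Sigma$. A rotational surface is a surface invariant under the one-parameter group of rotations about a fixed axis; after a rigid motion taking the axis to the $z$-axis, it is parametrized by $\Psi(s,t)=(x(s)\cos t,x(s)\sin t,z(s))$, $s\in I$, $t\in\mathbb{R}$, where $I$ is an interval and the generating curve $\gamma(s)=(x(s),0,z(s))$ is smooth, parametrized by arc-length, with $x(s)>0$. *)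

(* Defs.v *)
From HB Require Import structures.
From mathcomp Require Import all_boot all_order all_algebra.
From mathcomp Require Import all_classical all_reals all_analysis.
Set Implicit Arguments.
Unset Strict Implicit.
Unset Printing Implicit Defensive.
Import Order.TTheory GRing.Theory Num.Theory.
Import numFieldNormedType.Exports.
Local Open Scope ring_scope.
Local Open Scope classical_set_scope.

Section Euclidean3.
Variable R : realType.
Implicit Types (u v p a : 'rV[R]_3).

Definition vec3 (x y z : R) : 'rV[R]_3 :=
  \row_i [tuple x; y; z]`_i.

Definition dotv u v : R := (u *m v^T) 0 0.

(* The canonical norm `|v| on 'rV[R]_3 is the sup norm, whence this one. *)
Definition enorm v : R := Num.sqrt (dotv v v).

Definition parallel u v : Prop := exists2 c : R, c != 0 & v = c *: u.

Definition line p a : set 'rV[R]_3 := [set p + c *: a | c in [set: R]].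

Definition z_axis : set 'rV[R]_3 := line 0 (vec3 0 0 1).

Definition is_plane (P : set 'rV[R]_3) : Prop :=
  exists n : 'rV[R]_3, exists c : R, n != 0 /\ P = [set p | dotv p n = c].

Definition rigid_motion (g : 'rV[R]_3 -> 'rV[R]_3) : Prop :=
  exists Q : 'M[R]_3, exists b : 'rV[R]_3,
    [/\ Q *m Q^T = 1%:M, \det Q = 1 & forall p, g p = p *m Q + b].

End Euclidean3.

(* A surface is given by a parametrization X : R -> R -> R^3, of which only the
   values near D matter, and an orientation by a unit normal field N along X. *)
Section Surfaces.
Variable R : realType.
Implicit Types (X N : R -> R -> 'rV[R]_3) (D : set (R * R)).

Definition partial1 X : R -> R -> 'rV[R]_3 :=
  fun s t => derive1 (fun s' => X s' t) s.

Definition partial2 X : R -> R -> 'rV[R]_3 :=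
  fun s t => derive1 (X s) t.

Definition surface D X : set 'rV[R]_3 := [set X q.1 q.2 | q in D].

Definition immersed D X : Prop :=
  forall s t, D (s, t) -> row_free (col_mx (partial1 X s t) (partial2 X s t)).

Definition unit_normal_field D X N : Prop :=
  {within D, continuous (fun q : R * R => N q.1 q.2)} /\
  forall s t, D (s, t) ->
    [/\ enorm (N s t) = 1, dotv (N s t) (partial1 X s t) = 0 &
        dotv (N s t) (partial2 X s t) = 0].

Definition gauss_curvature X N (s t : R) : R :=
  let E := dotv (partial1 X s t) (partial1 X s t) in
  let F := dotv (partial1 X s t) (partial2 X s t) in
  let G := dotv (partial2 X s t) (partial2 X s t) in
  let e := dotv (partial1 (partial1 X) s t) (N s t) in
  let f := dotv (partial2 (partial1 X) s t) (N s t) in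
  let g := dotv (partial2 (partial2 X) s t) (N s t) in
  (e * g - f ^+ 2) / (E * G - F ^+ 2).

Definition translator (lambda : R) (v : 'rV[R]_3) D X N : Prop :=
  [/\ immersed D X, unit_normal_field D X N &
      forall s t, D (s, t) ->
        gauss_curvature X N s t = dotv (N s t) v + lambda].

End Surfaces.

Section Rotational.
Variable R : realType.

Definition nondegenerate_interval (I : set R) : Prop :=
  is_interval I /\ exists a b : R, [/\ I a, I b & a < b].

(* I need not be open: smoothness at its endpoints means that f extends
   smoothly across them, f itself being such an extension. *)
Definition smooth_on (I : set R) (f : R -> R) : Prop :=
  exists U : set R, [/\ open U, I `<=` U &
    forall (n : nat) (s : R), U s -> derivable (derive1n n f) s 1].

Definition generating_curve (I : set R) (x z : R -> R) : Prop :=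
  [/\ smooth_on I x, smooth_on I z,
      forall s, I s -> (derive1 x s) ^+ 2 + (derive1 z s) ^+ 2 = 1 &
      forall s, I s -> 0 < x s].

Definition revolution (x z : R -> R) (s t : R) : 'rV[R]_3 :=
  vec3 (x s * cos t) (x s * sin t) (z s).

(* The equation on X is required for all s, rather than for s in I, so that the
   derivatives of X at an endpoint of I are those of the extended curve. *)
Definition rotational_surface (p a : 'rV[R]_3) (I : set R)
    (X : R -> R -> 'rV[R]_3) : Prop :=
  nondegenerate_interval I /\
  exists g : 'rV[R]_3 -> 'rV[R]_3, exists x z : R -> R,
    [/\ rigid_motion g, g @` line p a = @z_axis R, generating_curve I x z &
        forall s t, g (X s t) = revolution x z s t].

End Rotational.

(* Main.v *)
Require Import Defs.
From mathcomp Require Import all_boot all_order all_algebra.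
From mathcomp Require Import all_classical all_reals all_analysis.
From mathcomp Require Import ring lra.
Set Implicit Arguments.
Unset Strict Implicit.
Unset Printing Implicit Defensive.

(** After a rigid motion taking the axis to the z-axis, let [w] be the image of
    [v], with components [w1], [w2], [w3]. Rotations about the axis are
    isometries, so along a parallel (the circle [s = const]) the Gauss curvature
    [K] does not depend on the angle [t]; see [gauss_curvature_revolution].
    The unit normal does depend on [t]: up to a sign it is
    [(z' cos t, z' sin t, - x')], by [unit_normal_revolution]. Squaring
    [K - lambda = <N, v>] removes the sign, which may a priori depend on the
    point, and gives
      [(z' w1 cos t + z' w2 sin t - x' w3)^2 = (K - lambda)^2],
    where the right-hand side is constant in [t]. A trigonometric polynomial of
    degree one whose square is constant has no nonconstant part
    ([sqr_trig_const_coef0]), so [z' w1 = z' w2 = 0] for every [s].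

    If [w1 = w2 = 0], then [w] is a nonzero multiple of the direction of the
    z-axis, that is, [v] is parallel to the rotation axis. Otherwise [z' = 0]
    on the whole interval, [z] is constant there, and the surface lies in a
    plane orthogonal to the axis. *)

Import Order.TTheory GRing.Theory Num.Theory.
Import numFieldNormedType.Exports.
Local Open Scope ring_scope.
Local Open Scope classical_set_scope.

(** * Vectors in coordinates *)

Section Vec3.
Variable R : realType.
Implicit Types (u v : 'rV[R]_3) (M Q : 'M[R]_3).

Lemma vec3_row u : u = vec3 (u 0 0) (u 0 1) (u 0 2%:R).
Proof.
apply/rowP => i; rewrite mxE; case: i => [[|[|[|//]]] ?] /=;
  by congr (u _ _); apply/val_inj.
Qed.

Lemma dotv_vec3 (x y z x' y' z' : R) :
  dotv (vec3 x y z) (vec3 x' y' z') = x * x' + y * y' + z * z'.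
Proof.
by rewrite /dotv mxE !big_ord_recl big_ord0 !mxE /= addr0 addrA.
Qed.

Lemma dotv_mulmx u v M : dotv (u *m M) v = dotv u (v *m M^T).
Proof. by rewrite /dotv trmx_mul trmxK mulmxA. Qed.

Lemma dotv_enorm1 u : enorm u = 1 -> dotv u u = 1.
Proof.
rewrite /enorm => u1; have : Num.sqrt (dotv u u) ^+ 2 = 1 by rewrite u1 expr1n.
rewrite sqr_sqrtr //.
by rewrite (vec3_row u) dotv_vec3 -!expr2 !addr_ge0 ?sqr_ge0.
Qed.

(** Differentiation is entrywise, and commutes with the affine map
    [u |-> u *m M + b]; this reduces every partial derivative of a moved surface
    of revolution to scalar derivatives. *)
Lemma is_derive_vec3 M (b : 'rV[R]_3) (f1 f2 f3 : R -> R) (d1 d2 d3 s : R) :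
  is_derive s 1 f1 d1 -> is_derive s 1 f2 d2 -> is_derive s 1 f3 d3 ->
  is_derive s 1 (fun s => vec3 (f1 s) (f2 s) (f3 s) *m M + b)
    (vec3 d1 d2 d3 *m M).
Proof.
move=> h1 h2 h3.
set F := fun s => _.
have E i j x y z : (vec3 x y z *m M) i j = x * M 0 j + y * M 1 j + z * M 2%:R j.
  rewrite mxE !big_ord_recl big_ord0 !mxE /= addr0 addrA.
  by congr (_ + _ * _ + _ * _); congr (M _ _); apply/val_inj.
have D i j : is_derive s 1 (fun s => F s i j) ((vec3 d1 d2 d3 *m M) i j).
  have -> : (fun s => F s i j) =
      f1 * cst (M 0 j) + f2 * cst (M 1 j) + f3 * cst (M 2%:R j) + cst (b i j).
    by apply/funext => r; rewrite /F mxE E.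
  apply: is_derive_eq; rewrite E !scaler0 !add0r addr0.
  by rewrite /GRing.scale /=; ring.
have dF : derivable F s 1 by apply/derivable_mxP => i j; case: (D i j).
split => //; rewrite derive_mx //; apply/matrixP => i j; rewrite mxE.
by case: (D i j).
Qed.

Lemma derive1_vec3 M (b : 'rV[R]_3) (f1 f2 f3 : R -> R) (d1 d2 d3 s : R) :
  is_derive s 1 f1 d1 -> is_derive s 1 f2 d2 -> is_derive s 1 f3 d3 ->
  derive1 (fun s => vec3 (f1 s) (f2 s) (f3 s) *m M + b) s = vec3 d1 d2 d3 *m M.
Proof.
move=> h1 h2 h3; rewrite derive1E.
by have [_ ->] := is_derive_vec3 M b h1 h2 h3.
Qed.

End Vec3.

(** * One-variable calculus *)

Section Calculus.
Variable R : realType.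
Implicit Types (f : R -> R) (s d k : R).

Lemma is_derive_mulr f s d k :
  is_derive s 1 f d -> is_derive s 1 (fun r => f r * k) (d * k).
Proof.
move=> h; have -> : (fun r => f r * k) = f * cst k by [].
by apply: is_derive_eq; rewrite scaler0 add0r /GRing.scale /= mulrC.
Qed.

Lemma is_derive_mull f s d k :
  is_derive s 1 f d -> is_derive s 1 (fun r => k * f r) (k * d).
Proof.
move=> h; under eq_fun do rewrite mulrC.
by rewrite mulrC; exact: is_derive_mulr.
Qed.

Lemma derivable1_is_derive f s :
  derivable f s 1 -> is_derive s 1 f (derive1 f s).
Proof. by move=> h; rewrite derive1E; exact: derivableP. Qed.

(** The function need only be differentiable on [I], so the mean value theorem
    is applied on each segment contained in [I]. *)
Lemma derive1_eq0_interval_cst (I : set R) f : is_interval I ->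
  (forall s, I s -> derivable f s 1) -> (forall s, I s -> derive1 f s = 0) ->
  forall s r, I s -> I r -> f s = f r.
Proof.
move=> itvI df f0.
suff H s r : I s -> I r -> s <= r -> f s = f r.
  by move=> s r Is Ir; case: (leP s r) => [|/ltW] h; [|symmetry]; exact: H.
move=> Is Ir sr.
have sub y : y \in `[s, r]%R -> I y.
  by rewrite in_itv /=; exact: itvI.
have [||y /sub Iy] := @MVT_segment R f (derive1 f) s r sr.
- move=> y ysr; apply/derivable1_is_derive/df/sub.
  exact: subset_itv_oo_cc ysr.
- by apply: derivable_within_continuous => y /sub /df.
- by rewrite f0 // mul0r => /eqP; rewrite subr_eq0 => /eqP.
Qed.

(** The angles [0] and [pi] give [A * C = 0], the angles [pi / 2] and
    [- (pi / 2)] give [B * C = 0], and together they give [A ^+ 2 = B ^+ 2].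
    At any angle with nonzero sine and cosine, such as [pi / 4], the cross term
    [2 * A * B * cos t * sin t] is then the only one left, so [A * B = 0]. *)
Lemma sqr_trig_const_coef0 (A B C K : R) :
  (forall t, (A * cos t + B * sin t + C) ^+ 2 = K) -> A = 0 /\ B = 0.
Proof.
move=> h.
have := h 0; have := h pi; have := h (pi / 2); have := h (- (pi / 2)).
have := h (pi / 4).
rewrite cosN sinN cos_pihalf sin_pihalf cospi sinpi cos0 sin0.
have p0 := pi_gt0 R.
have c0 : cos (pi / 4 : R) != 0.
  by apply/lt0r_neq0/cos_gt0_pihalf; apply/andP; split; lra.
have s0 : sin (pi / 4 : R) != 0.
  by apply/lt0r_neq0/sin_gt0_pi; apply/andP; split; lra.
have := cos2Dsin2 (pi / 4 : R).
move: c0 s0; move: (cos _) (sin _) => C' S' c0 s0 cs h4 h3 h2 h1 h0.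
have AC : A * C = 0 by lra.
have BC : B * C = 0 by lra.
have AB2 : A ^+ 2 = B ^+ 2 by lra.
have AB : A * B = 0.
  apply: (mulIf c0); apply: (mulIf s0); rewrite !mul0r.
  have E : (A * C' + B * S' + C) ^+ 2 = A ^+ 2 * C' ^+ 2 + B ^+ 2 * S' ^+ 2
    + C ^+ 2 + 2 * (A * B * C' * S') + 2 * (A * C) * C' + 2 * (B * C) * S'.
    by ring.
  move: h4; rewrite E AC BC -AB2 -mulrDr cs; lra.
have A0 : A = 0.
  by move/eqP: AB; rewrite mulf_eq0 => /orP[/eqP//|/eqP B0]; move/eqP: AB2;
    rewrite B0 expr0n /= sqrf_eq0 => /eqP.
by split => //; move/esym/eqP: AB2; rewrite A0 expr0n /= sqrf_eq0 => /eqP.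
Qed.

End Calculus.

(** * Local geometry of a surface of revolution *)

Section Revolution.
(* The orthogonal matrix M and the vector c put the surface in arbitrary
   position; U is an open neighbourhood of the parameter interval of the curve,
   needed to differentiate twice at the endpoints of that interval. *)
Variables (R : realType) (M : 'M[R]_3) (c : 'rV[R]_3) (x z : R -> R).
Variable U : set R.
Hypotheses (MM : M *m M^T = 1%:M) (openU : open U).
Hypotheses (smooth_x : forall n s, U s -> derivable (derive1n n x) s 1).
Hypotheses (smooth_z : forall n s, U s -> derivable (derive1n n z) s 1).
Let X s t := revolution x z s t *m M + c.

Lemma partial1_revolution s t : U s ->
  partial1 X s t =
  vec3 (derive1 x s * cos t) (derive1 x s * sin t) (derive1 z s) *m M.
Proof.
move=> Us; have dx := derivable1_is_derive (@smooth_x 0%N s Us).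
have dz := derivable1_is_derive (@smooth_z 0%N s Us).
by apply: derive1_vec3 => //; exact: is_derive_mulr.
Qed.

Lemma partial2_revolution s t :
  partial2 X s t = vec3 (x s * - sin t) (x s * cos t) 0 *m M.
Proof.
by apply: derive1_vec3; apply: is_derive_mull.
Qed.

Lemma partial11_revolution s t : U s ->
  partial1 (partial1 X) s t =
  vec3 (derive1n 2 x s * cos t) (derive1n 2 x s * sin t) (derive1n 2 z s) *m M.
Proof.
move=> Us; rewrite {1}/partial1.
have dx := derivable1_is_derive (@smooth_x 1%N s Us).
have dz := derivable1_is_derive (@smooth_z 1%N s Us).
rewrite derive1E.
have /near_eq_derive -> : \near s, partial1 X s t =
  vec3 (derive1 x s * cos t) (derive1 x s * sin t) (derive1 z s) *m M + 0.
  by near=> r; rewrite addr0 partial1_revolution //; near: r; exact: open_nbhs_nbhs.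
by rewrite -derive1E; apply: derive1_vec3 => //; exact: is_derive_mulr.
Unshelve. all: by end_near. Qed.

Lemma partial12_revolution s t : U s ->
  partial2 (partial1 X) s t =
  vec3 (derive1 x s * - sin t) (derive1 x s * cos t) 0 *m M.
Proof.
move=> Us; rewrite /partial2.
have -> : partial1 X s = fun t =>
  vec3 (derive1 x s * cos t) (derive1 x s * sin t) (derive1 z s) *m M + 0.
  by apply/funext => r; rewrite addr0 partial1_revolution.
by apply: derive1_vec3; apply: is_derive_mull.
Qed.

Lemma partial22_revolution s t :
  partial2 (partial2 X) s t = vec3 (x s * - cos t) (x s * - sin t) 0 *m M.
Proof.
rewrite {1}/partial2.
have -> : partial2 X s = fun t => vec3 (x s * - sin t) (x s * cos t) 0 *m M + 0.
  by apply/funext => r; rewrite addr0 partial2_revolution.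
by apply: derive1_vec3; apply: is_derive_mull.
Qed.

(** Orthogonality to the parallel says that the horizontal part of the normal is
    radial, [r (cos t, sin t)]; orthogonality to the meridian then makes
    [(r, n3)], in the plane through the axis, a unit vector orthogonal to the
    unit vector [(x', z')], hence [+/- (z', - x')]. *)
Lemma unit_normal_revolution s t (n : 'rV[R]_3) :
  U s -> x s != 0 -> derive1 x s ^+ 2 + derive1 z s ^+ 2 = 1 ->
  dotv n n = 1 -> dotv n (partial1 X s t) = 0 -> dotv n (partial2 X s t) = 0 ->
  exists2 e : R, e ^+ 2 = 1 &
    n = vec3 (e * (derive1 z s * cos t)) (e * (derive1 z s * sin t))
             (- e * derive1 x s) *m M.
Proof.
move=> Us x0 arc nn; rewrite partial1_revolution // partial2_revolution.
have {nn} : dotv (n *m M^T) (n *m M^T) = 1.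
  by rewrite dotv_mulmx trmxK -mulmxA (mulmx1C MM) mulmx1.
have -> : n = n *m M^T *m M by rewrite -mulmxA (mulmx1C MM) mulmx1.
rewrite !(dotv_mulmx _ (_ *m M)) -!(mulmxA _ M) MM !mulmx1.
set m := n *m M^T; rewrite (vec3_row m) !dotv_vec3.
move: (m 0 0) (m 0 1) (m 0 2%:R) => n1 n2 n3.
have cs := cos2Dsin2 t.
move: x0 arc cs; move: (x s) (derive1 x s) (derive1 z s) (cos t) (sin t).
move=> y x' z' C S y0 arc cs nn n1p n2p.
have {n2p} n2p : n1 * S = n2 * C.
  apply: (mulfI y0); apply/eqP; rewrite -subr_eq0 -oppr_eq0 -[X in _ == X]n2p.
  by apply/eqP; ring.
have [r n1E n2E] : exists2 r, n1 = r * C & n2 = r * S.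
  exists (n1 * C + n2 * S).
  - rewrite -[LHS]mulr1 -cs (_ : _ * C = n1 * C ^+ 2 + (n2 * C) * S); last by ring.
    by rewrite -n2p; ring.
  - rewrite -[LHS]mulr1 -cs (_ : _ * S = (n1 * S) * C + n2 * S ^+ 2); last by ring.
    by rewrite n2p; ring.
rewrite {}n1E {}n2E {n2p} in nn n1p *.
have {nn} rn3 : r ^+ 2 + n3 ^+ 2 = 1.
  by rewrite -nn -[r ^+ 2]mulr1 -cs; ring.
have {n1p} tn : x' * r + z' * n3 = 0.
  by rewrite -n1p -[x' * r]mulr1 -cs; ring.
(* The sign is the inner product of (r, n3) with (z', - x'), and its square
   is computed by Lagrange's identity. *)
exists (r * z' - n3 * x').
  have -> : (r * z' - n3 * x') ^+ 2 = (r ^+ 2 + n3 ^+ 2) * (x' ^+ 2 + z' ^+ 2)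
    - (x' * r + z' * n3) ^+ 2 by ring.
  by rewrite rn3 arc tn expr0n /= mulr1 subr0.
have rE : (r * z' - n3 * x') * z' = r.
  have -> : (r * z' - n3 * x') * z' =
    r * (x' ^+ 2 + z' ^+ 2) - x' * (x' * r + z' * n3) by ring.
  by rewrite arc tn mulr0 mulr1 subr0.
have n3E : - (r * z' - n3 * x') * x' = n3.
  have -> : - (r * z' - n3 * x') * x' =
    n3 * (x' ^+ 2 + z' ^+ 2) - z' * (x' * r + z' * n3) by ring.
  by rewrite arc tn mulr0 mulr1 subr0.
by rewrite !(mulrA _ z') rE n3E.
Qed.

(** The value involves [s] only. The sign of the unit normal at [(s, t)]
    disappears because the curvature is quadratic in it. *)
Lemma gauss_curvature_revolution s t N :
  U s -> 0 < x s -> derive1 x s ^+ 2 + derive1 z s ^+ 2 = 1 ->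
  dotv (N s t) (N s t) = 1 -> dotv (N s t) (partial1 X s t) = 0 ->
  dotv (N s t) (partial2 X s t) = 0 ->
  gauss_curvature X N s t =
  derive1 z s * (derive1 x s * derive1n 2 z s - derive1 z s * derive1n 2 x s)
    / x s.
Proof.
move=> Us x0 arc nn n1 n2.
have [e e2 NE] := unit_normal_revolution Us (lt0r_neq0 x0) arc nn n1 n2.
rewrite /gauss_curvature NE partial11_revolution // partial12_revolution //.
rewrite partial22_revolution partial1_revolution // partial2_revolution.
rewrite !(dotv_mulmx _ (_ *m M)) -!(mulmxA _ M) MM !mulmx1 !dotv_vec3.
have := cos2Dsin2 t; move: arc (lt0r_neq0 x0) e2.
move: (x s) (derive1 x s) (derive1 z s) (derive1n 2 x s) (derive1n 2 z s).
move: (cos t) (sin t) => C S y x' z' x'' z'' arc y0 e2 cs.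
(* T = 1; it is kept as a factor to make the simplifications below ring
   identities. *)
pose T := C ^+ 2 + S ^+ 2.
have -> : x'' * C * (e * (z' * C)) + x'' * S * (e * (z' * S)) + z'' * (- e * x')
  = e * (x'' * z' * T - z'' * x') by rewrite /T; ring.
have -> : y * - C * (e * (z' * C)) + y * - S * (e * (z' * S)) + 0 * (- e * x')
  = - e * y * z' * T by rewrite /T; ring.
have -> : x' * - S * (e * (z' * C)) + x' * C * (e * (z' * S)) + 0 * (- e * x')
  = 0 by ring.
have -> : x' * C * (x' * C) + x' * S * (x' * S) + z' * z'
  = x' ^+ 2 * T + z' ^+ 2 by rewrite /T; ring.
have -> : y * - S * (y * - S) + y * C * (y * C) + 0 * 0 = y ^+ 2 * T.
  by rewrite /T; ring.
have -> : x' * C * (y * - S) + x' * S * (y * C) + z' * 0 = 0 by ring.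
rewrite /T cs !mulr1 arc.
have -> : e * (x'' * z' - z'' * x') * (- e * y * z') =
  e ^+ 2 * (y * (z' * (x' * z'' - z' * x''))) by ring.
by rewrite e2; field.
Qed.

End Revolution.

(** * The rotation axis *)

Section RotationAxis.
Variable R : realType.
Implicit Types (p a b : 'rV[R]_3) (Q : 'M[R]_3).

(** The direction [a] cannot be zero, since the line would then be a single
    point and so would its image. *)
Lemma image_line_z_axis p a Q b (g : 'rV[R]_3 -> 'rV[R]_3) :
  (forall q, g q = q *m Q + b) -> g @` line p a = @z_axis R ->
  exists2 k : R, k != 0 & a *m Q = k *: vec3 0 0 1.
Proof.
move=> gE im.
have on_axis r : exists k, g (p + r *: a) = k *: vec3 0 0 1.
  have : z_axis (g (p + r *: a)) by rewrite -im; exists (p + r *: a) => //; exists r.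
  by move=> [k _ <-]; exists k; rewrite add0r.
have step r : g (p + r *: a) = g p + r *: (a *m Q).
  by rewrite !gE mulmxDl -scalemxAl addrAC.
have [k0 g0] := on_axis 0; have [k1 g1] := on_axis 1.
rewrite !step !scale0r !scale1r ?addr0 in g0 g1.
have aQ : a *m Q = (k1 - k0) *: vec3 0 0 1.
  by rewrite scalerBl -g1 -g0 addrC addKr.
exists (k1 - k0) => //; apply/eqP => k0_; rewrite k0_ scale0r in aQ.
have single (c : R) : c *: vec3 0 0 1 = g p.
  have : z_axis (c *: vec3 0 0 1 : 'rV[R]_3) by exists c => //; rewrite add0r.
  by rewrite -im => -[_ [r _ <-] <-]; rewrite step aQ scaler0 addr0.
have := single 1; rewrite -(single 0) scale1r scale0r => /rowP /(_ 2%:R).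
by rewrite !mxE /= => /eqP; rewrite oner_eq0.
Qed.

End RotationAxis.

(** * Rotational translators *)

Theorem proposition3p1 (R : realType) (v p a : 'rV[R]_3) (I : set R)
    (X N : R -> R -> 'rV[R]_3) :
  enorm v = 1 ->
  rotational_surface p a I X ->
  (exists lambda : R, translator lambda v (I `*` [set: R]) X N) ->
  (exists2 P : set 'rV[R]_3, is_plane P & surface (I `*` [set: R]) X `<=` P)
  \/ parallel a v.
Proof.
move=> v1 [[itvI [s0 [_ [Is0 _ _]]]] [g [x [z [[Q [b [QQ _ gE]]] axis curve gX]]]]].
move=> [lambda [_ [_ normal] KE]].
have [[U [openU IU dU]] [W [openW IW dW]] arc xpos] := curve.
have MM : Q^T *m Q^T^T = 1%:M by rewrite trmxK; exact: mulmx1C.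
have XE : X = fun s t => revolution x z s t *m Q^T + - (b *m Q^T).
  apply/funext => s; apply/funext => t.
  by rewrite -gX gE mulmxDl addrK -mulmxA QQ mulmx1.
have openV : open (U `&` W) by exact: openI.
have smooth_x n s : (U `&` W) s -> derivable (derive1n n x) s 1.
  by move=> [Us _]; exact: dU.
have smooth_z n s : (U `&` W) s -> derivable (derive1n n z) s 1.
  by move=> [_ Ws]; exact: dW.
pose w := v *m Q.
have key s : I s -> derive1 z s * w 0 0 = 0 /\ derive1 z s * w 0 1 = 0.
  move=> Is; have Vs : (U `&` W) s by split; [exact: IU|exact: IW].
  apply: (@sqr_trig_const_coef0 R _ _ (- derive1 x s * w 0 2%:R)
    ((derive1 z s * (derive1 x s * derive1n 2 z s - derive1 z s * derive1n 2 x s)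
      / x s - lambda) ^+ 2)) => t.
  have Dst : (I `*` [set: R]) (s, t) by [].
  have [/dotv_enorm1 nn n1 n2] := normal s t Dst.
  have := KE s t Dst; rewrite XE in n1 n2 *.
  rewrite (gauss_curvature_revolution MM openV smooth_x smooth_z Vs
    (xpos s Is) (arc s Is) nn n1 n2) => ->; rewrite addrK.
  have [e e2 ->] := unit_normal_revolution MM smooth_x smooth_z Vs
    (lt0r_neq0 (xpos s Is)) (arc s Is) nn n1 n2.
  rewrite dotv_mulmx trmxK -/w [X in dotv _ X](vec3_row w) dotv_vec3.
  (* Multiplying by e ^+ 2 = 1 absorbs the sign of the normal. *)
  rewrite -[LHS]mul1r -e2; ring.
(* The sum of squares vanishes exactly when w lies on the z-axis. *)
have [w0|wn0] := eqVneq (w 0 0 ^+ 2 + w 0 1 ^+ 2) 0.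
  right.
  have [k k0 aQ] := image_line_z_axis gE axis.
  move/eqP: w0; rewrite paddr_eq0 ?sqr_ge0 // !sqrf_eq0 => /andP[/eqP w0 /eqP w1].
  have wE : w = w 0 2%:R *: vec3 0 0 1.
    rewrite {1}(vec3_row w) w0 w1; apply/rowP => i.
    by rewrite !mxE; case: i => [[|[|[|//]]] ?] /=; rewrite ?mulr0 ?mulr1.
  have vE : v = (w 0 2%:R / k) *: a.
    rewrite -[v]mulmx1 -QQ mulmxA -/w {1}wE -[a]mulmx1 -QQ mulmxA aQ.
    by rewrite -!scalemxAl scalerA divfK.
  exists (w 0 2%:R / k) => //; apply/eqP => c0.
  move: (dotv_enorm1 v1); rewrite vE c0 scale0r /dotv mul0mx mxE => /eqP.
  by rewrite eq_sym oner_eq0.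
left.
have dz s : I s -> derive1 z s = 0.
  move=> /key [h0 h1]; apply: (mulIf wn0); rewrite mul0r mulrDr !expr2.
  by rewrite !mulrA h0 h1 !mul0r addr0.
(* Written in the original position, the plane through the height z s0. *)
exists [set q | dotv q (vec3 0 0 1 *m Q^T) = z s0 - b 0 2%:R].
  exists (vec3 0 0 1 *m Q^T), (z s0 - b 0 2%:R); split => //.
  apply/eqP => n0; have := dotv_vec3 (0 : R) 0 1 0 0 1.
  rewrite -{2}[vec3 0 0 1]mulmx1 -MM mulmxA -dotv_mulmx n0 /dotv mul0mx mxE.
  by rewrite !mul0r !add0r mulr1 => /eqP; rewrite eq_sym oner_eq0.
move=> _ [[s t] [/= Is _] <-] /=.
have -> : z s0 = z s by apply: (derive1_eq0_interval_cst itvI) => // r Ir; exact: dW 0%N _ (IW _ Ir).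
rewrite XE -mulNmx -mulmxDl dotv_mulmx -mulmxA MM mulmx1 {1}(vec3_row b).
rewrite /dotv !mxE !big_ord_recl big_ord0 !mxE /= !mulr0 !mulr1; ring.
Qed.
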